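(* Let $k$ be a field, $R=k[x,y]$, and $I=(x^d,y^d,x^by^{d-b})$ with $d\ge2$, $1\le b\le d-b$ and $\gcd(d,b)=1$. Then the Rees algebra $\mathcal R_R(I)$ is almost Cohen--Macaulay, and it is Cohen--Macaulay if and only if $d=2$.
   Context: For an ideal $I\subset k[x,y]$, the Rees algebra $\mathcal R_R(I)=R[IT]$ has dimension $3$; it is almost Cohen--Macaulay if its depth (at the maximal homogeneous ideal) is at least $2$. *)

(* Defs.v *)
(* k[x,y] is modelled as {poly {poly k}} (inner variable x,
   outer variable y); k[x,y][T] as {poly {poly {poly k}}} (outer variable T). *)
From Stdlib Require Import List.
From HB Require Import structures.
From mathcomp Require Import all_boot all_order all_algebra.
Set Implicit Arguments. Unset Strict Implicit. Unset Printing Implicit Defensive.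
Import GRing.Theory.
Local Open Scope ring_scope.

Section Defs.
Variable k : fieldType.

Definition Rxy := {poly {poly k}}.
Definition RT := {poly Rxy}.

Definition varx : Rxy := ('X)%:P.
Definition vary : Rxy := 'X.

Definition in_ideal (A : comNzRingType) (gs : seq A) (f : A) : Prop :=
  exists cs : seq A, size cs = size gs /\
    f = \sum_(i < size gs) cs`_i * gs`_i.

Fixpoint pow_gens (A : comNzRingType) (gs : seq A) (n : nat) : seq A :=
  match n with
  | 0 => [:: 1]
  | n'.+1 => [seq a * b | a <- gs, b <- pow_gens gs n']
  end.

Definition Igens (d b : nat) : seq Rxy :=
  [:: varx ^+ d; vary ^+ d; varx ^+ b * vary ^+ (d - b)].

Definition rees (gs : seq Rxy) : RT -> Prop :=
  fun F => forall n : nat, in_ideal (pow_gens gs n) F`_n.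

Definition max_hom (S : RT -> Prop) : RT -> Prop :=
  fun F => S F /\ F`_0`_0`_0 = 0.

Definition in_sub_ideal (S : (RT -> Prop)) (fs : seq RT) (g : RT) : Prop :=
  exists cs : seq RT, size cs = size fs /\ (forall c, In c cs -> S c) /\
    g = \sum_(i < size fs) cs`_i * fs`_i.

Definition regular_seq (S : (RT -> Prop)) (m : (RT -> Prop)) (fs : seq RT) : Prop :=
  (forall f, In f fs -> m f) /\
  (forall i : nat, (i < size fs)%N -> forall g, S g ->
      in_sub_ideal S (take i fs) (g * fs`_i) -> in_sub_ideal S (take i fs) g) /\
  ~ in_sub_ideal S fs 1.

Definition depth_ge (S m : (RT -> Prop)) (n : nat) : Prop :=
  exists fs : seq RT, size fs = n /\ regular_seq S m fs.

Definition prime_ideal (S : (RT -> Prop)) (P : (RT -> Prop)) : Prop :=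
  (forall f, P f -> S f) /\ P 0 /\
  (forall f g, P f -> P g -> P (f + g)) /\
  (forall s f, S s -> P f -> P (s * f)) /\
  ~ P 1 /\
  (forall f g, S f -> S g -> P (f * g) -> P f \/ P g).

Definition krull_dim_ge (S : (RT -> Prop)) (n : nat) : Prop :=
  exists Ps : nat -> (RT -> Prop),
    (forall i, (i <= n)%N -> prime_ideal S (Ps i)) /\
    (forall i, (i < n)%N ->
       (forall f, Ps i f -> Ps i.+1 f) /\
       exists f, Ps i.+1 f /\ ~ Ps i f).

(* almost Cohen-Macaulay: depth at the maximal homogeneous ideal >= dim - 1
   (= 2 here, dim R[IT] = 3) *)
Definition almost_CM (S : (RT -> Prop)) : Prop :=
  forall n, krull_dim_ge S n.+1 -> depth_ge S (max_hom S) n.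

(* Cohen-Macaulay (graded, at the maximal homogeneous ideal): depth = dim *)
Definition CM (S : (RT -> Prop)) : Prop :=
  forall n, krull_dim_ge S n -> depth_ge S (max_hom S) n.

End Defs.

(* Main.v *)
(* R[IT] is spanned over k by the monomials x^i y^j T^n with x^i y^j in I^n; write S for
   it, K for k[x,y,T], m for the maximal homogeneous ideal and g for (x^d - y^d) T.

   Dimension: four elements of K are algebraically dependent over k, by counting
   monomials; along a chain of primes P_0 < P_1 < ... with x_i in P_(i+1) \ P_i, a nonzero
   polynomial in x_j, ..., x_3 never lies in P_j. Hence dim S <= 3.

   Depth at least 2: if F in K and g F in S, then F in S, so g, x is a regular sequence.

   Depth less than 3 when d > 2: the element s = x^(d-b) y^(b+d(d-3)) T^(d-2) satisfies
   m s <= S + g K but s is not in S + g K. Writing x s = u + g t with u in S gives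
   m u <= (g, x) and u not in (g, x), that is, Ext^2(k, S) <> 0; Koszul syzygies turn this
   into a contradiction with the existence of a regular sequence of length three.

   Depth 3 when d = 2: the sequence x, y^2 T, y - x^2 T is regular. *)
Require Import Defs.
From HB Require Import structures.
From mathcomp Require Import all_boot all_order all_algebra.
From mathcomp Require Import zify ring.
Set Implicit Arguments. Unset Strict Implicit. Unset Printing Implicit Defensive.
Import GRing.Theory.
Local Open Scope ring_scope.

(** * Koszul relations of regular sequences in a subring of a domain *)

Section Exchange.
Variables (A : idomainType) (S : A -> Prop).
Hypotheses (SD : forall f g, S f -> S g -> S (f + g)).
Hypotheses (SN : forall f, S f -> S (- f)) (SM : forall f g, S f -> S g -> S (f * g)).

(** Regularity of a pair on S, stripped of properness; in a domain the condition on [f1] reduces to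
    being nonzero. *)
Definition weakly_regular2 (f1 f2 : A) := f1 != 0 /\
  forall a g, S a -> S g -> g * f2 = a * f1 -> exists2 w, S w & g = w * f1.

Lemma weakly_regular2_syzygy (f1 f2 a b : A) : weakly_regular2 f1 f2 -> S a -> S b ->
  a * f1 + b * f2 = 0 -> exists2 w, S w & a = - (w * f2) /\ b = w * f1.
Proof.
move=> [f10 reg] Sa Sb E.
have [|w Sw Ew] := reg (- a) b (SN Sa) Sb.
  by apply/eqP; rewrite mulNr -addr_eq0 addrC E.
exists w => //; split => //; apply: (mulIf f10).
have -> : a * f1 = - (b * f2) by apply/eqP; rewrite -addr_eq0 E.
by rewrite Ew; ring.
Qed.

(** Vanishing of the first Koszul homology: subtracting trivial syzygies removes the [f3] component
    and leaves a syzygy of [f1], [f2]. The conclusion writes (p, q, r) as the cross product of e and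
    f. *)
Lemma koszul3_syzygy (f1 f2 f3 p q r : A) :
  S f1 -> S f2 -> S f3 -> weakly_regular2 f1 f2 ->
  (forall g a b, S g -> S a -> S b -> g * f3 = a * f1 + b * f2 ->
    exists a' b', [/\ S a', S b' & g = a' * f1 + b' * f2]) ->
  S p -> S q -> S r -> p * f1 + q * f2 + r * f3 = 0 ->
  exists e1 e2 e3, [/\ S e1, S e2 & S e3] /\
    [/\ p = f3 * e2 - f2 * e3, q = f1 * e3 - f3 * e1 & r = f2 * e1 - f1 * e2].
Proof.
move=> S1 S2 S3 reg2 reg3 Sp Sq Sr E.
have [|s [t [Ss St Er]]] := reg3 r (- p) (- q) Sr (SN Sp) (SN Sq).
  by apply/eqP; rewrite -subr_eq0; apply/eqP; rewrite -[RHS]E; ring.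
have [|||z Sz [Ep Eq]] := @weakly_regular2_syzygy f1 f2 (p + f3 * s) (q + f3 * t) reg2.
- by apply: SD => //; apply: SM.
- by apply: SD => //; apply: SM.
- by rewrite -[RHS]E Er; ring.
exists t, (- s), z; split; first by split=> //; apply: SN.
split.
- by apply: (addIr (f3 * s)); rewrite Ep; ring.
- by apply: (addIr (f3 * t)); rewrite Eq; ring.
- by rewrite Er; ring.
Qed.

(* Ext^2 of the residue field is computed by any regular sequence of length two,
   hence vanishes as soon as a regular sequence of length three exists. *)
Lemma regular3_colon (f1 f2 f3 g1 g2 u : A) :
  S f1 -> S f2 -> S f3 -> S g1 -> S g2 -> S u ->
  weakly_regular2 f1 f2 ->
  (forall g a b, S g -> S a -> S b -> g * f3 = a * f1 + b * f2 ->
    exists a' b', [/\ S a', S b' & g = a' * f1 + b' * f2]) ->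
  weakly_regular2 g1 g2 ->
  (forall f, f \in [:: f1; f2; f3] ->
    exists a b, [/\ S a, S b & u * f = a * g1 + b * g2]) ->
  exists a b, [/\ S a, S b & u = a * g1 + b * g2].
Proof.
move=> S1 S2 S3 Sg1 Sg2 Su regf2 regf3 regg uf.
have [|a1 [b1 [Sa1 Sb1 E1]]] := uf f1; first by rewrite !inE eqxx.
have [|a2 [b2 [Sa2 Sb2 E2]]] := uf f2; first by rewrite !inE eqxx orbT.
have [|a3 [b3 [Sa3 Sb3 E3]]] := uf f3; first by rewrite !inE eqxx !orbT.
have f10 := regf2.1.
have g10 := regg.1.
(* Computing u f f' in two ways gives a syzygy of [g1], [g2], hence a multiple w of the Koszul
   one. *)
have cross f f' a b a' b' : S f -> S f' -> S a -> S b -> S a' -> S b' ->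
    u * f = a * g1 + b * g2 -> u * f' = a' * g1 + b' * g2 ->
    exists2 w, S w & f' * a - f * a' = - (w * g2) /\ f' * b - f * b' = w * g1.
  move=> Sf Sf' Sa Sb Sa' Sb' E E'.
  apply: (weakly_regular2_syzygy regg).
  - by apply: SD; [|apply: SN]; apply: SM.
  - by apply: SD; [|apply: SN]; apply: SM.
  transitivity (f' * (a * g1 + b * g2) - f * (a' * g1 + b' * g2)); first by ring.
  by rewrite -E -E'; ring.
have [c12 Sc12 [A12 B12]] := cross _ _ _ _ _ _ S1 S2 Sa1 Sb1 Sa2 Sb2 E1 E2.
have [c23 Sc23 [A23 B23]] := cross _ _ _ _ _ _ S2 S3 Sa2 Sb2 Sa3 Sb3 E2 E3.
have [c31 Sc31 [A31 B31]] := cross _ _ _ _ _ _ S3 S1 Sa3 Sb3 Sa1 Sb1 E3 E1.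
(* The vector (c23, c31, c12) is orthogonal to f, since [g1] times the pairing is a cyclic sum that
   cancels; so it is a cross product of some e with f. *)
have [|e1 [e2 [e3 [[Se1 Se2 Se3] [Ec23 Ec31 Ec12]]]]] :=
    koszul3_syzygy S1 S2 S3 regf2 regf3 Sc23 Sc31 Sc12.
  apply: (mulIf g10); rewrite mul0r.
  transitivity (f1 * (c23 * g1) + f2 * (c31 * g1) + f3 * (c12 * g1)); first by ring.
  by rewrite -B23 -B31 -B12; ring.
(* Passing to b_i - e_i g1 and a_i + e_i g2 kills the cross differences, so [f1] divides the
   corrected coefficients; the quotients are the coefficients of u. *)
have [|||w Sw Ew] := regf2.2 (b2 - e2 * g1) (b1 - e1 * g1).
- by apply: SD => //; apply: SN; apply: SM.
- by apply: SD => //; apply: SN; apply: SM.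
- apply/eqP; rewrite -subr_eq0; apply/eqP.
  transitivity ((f2 * b1 - f1 * b2) - (f2 * e1 - f1 * e2) * g1); first by ring.
  by rewrite B12 -Ec12 subrr.
have [|||v Sv Ev] := regf2.2 (a2 + e2 * g2) (a1 + e1 * g2).
- by apply: SD => //; apply: SM.
- by apply: SD => //; apply: SM.
- apply/eqP; rewrite -subr_eq0; apply/eqP.
  transitivity ((f2 * a1 - f1 * a2) + (f2 * e1 - f1 * e2) * g2); first by ring.
  by rewrite A12 -Ec12 addNr.
exists v, w; split=> //; apply: (mulIf f10); rewrite E1.
transitivity ((a1 + e1 * g2) * g1 + (b1 - e1 * g1) * g2); first by ring.
by rewrite Ev Ew; ring.
Qed.
End Exchange.

(** * Monomials, coefficients and supports in k[x,y,T] *)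

Section Monomials.
Variable k : fieldType.
Implicit Types (F G : RT k) (f g : Rxy k).

Definition mono2 (i j : nat) : Rxy k := varx k ^+ i * vary k ^+ j.
Definition mono (i j n : nat) : RT k := (mono2 i j)%:P * 'X^n.

Lemma mono2M i j i' j' : mono2 i j * mono2 i' j' = mono2 (i + i') (j + j').
Proof. by rewrite /mono2 !exprD mulrACA. Qed.

Lemma monoM i j n i' j' n' :
  mono i j n * mono i' j' n' = mono (i + i') (j + j') (n + n').
Proof. by rewrite /mono -mono2M (polyCM (mono2 i j)) exprD mulrACA. Qed.

Lemma mono000 : mono 0 0 0 = 1.
Proof. by rewrite /mono /mono2 !expr0 !mulr1. Qed.

Lemma mono2_coefM i j f u v : (mono2 i j * f)`_v`_u =
  if (i <= u)%N && (j <= v)%N then f`_(v - j)`_(u - i) else 0.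
Proof.
rewrite /mono2 /varx /vary -mulrA -polyC_exp coefCM coefXnM coefXnM.
by case: (ltnP v j); case: (ltnP u i) => //=; rewrite ?coef0.
Qed.

Lemma mono_coefM i j n F u v w : (mono i j n * F)`_w`_v`_u =
  if [&& i <= u, j <= v & n <= w]%N then F`_(w - n)`_(v - j)`_(u - i) else 0.
Proof.
rewrite /mono -mulrA coefCM mono2_coefM coefXnM.
by case: (ltnP w n); rewrite ?andbT ?andbF // ?coef0 ?if_same.
Qed.

Lemma mono2_ind (P : Rxy k -> Prop) : P 0 -> (forall f g, P f -> P g -> P (f + g)) ->
  forall f, (forall i j, f`_j`_i != 0 -> P ((f`_j`_i)%:P%:P * mono2 i j)) -> P f.
Proof.
move=> P0 PD f H; rewrite -[f]coefK poly_def.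
elim/big_ind: _ => // j _; rewrite -mul_polyC -[f`_j]coefK poly_def rmorph_sum mulr_suml.
elim/big_ind: _ => // i _; have [-> | ] := eqVneq f`_j`_i 0.
  by rewrite scale0r rmorph0 mul0r.
move/H; congr P.
by rewrite /mono2 /varx /vary mulrA -polyC_exp -polyCM; congr (_ %:P * _); rewrite mul_polyC.
Qed.

(** The case of a single term keeps the hypothesis that it occurs in F, so support conditions on F
    are available there. *)
Lemma mono_ind (P : RT k -> Prop) : P 0 -> (forall F G, P F -> P G -> P (F + G)) ->
  forall F, (forall i j n, F`_n`_j`_i != 0 -> P ((F`_n`_j`_i)%:P%:P%:P * mono i j n)) -> P F.
Proof.
move=> P0 PD F H; rewrite -[F]coefK poly_def.
elim/big_ind: _ => // n _; rewrite -mul_polyC.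
apply: (@mono2_ind (fun f => P (f%:P * 'X^n))) => [|f g Pf Pg|i j nz].
- by rewrite polyC0 mul0r.
- by rewrite polyCD mulrDl; apply: PD.
- by rewrite polyCM -mulrA; apply: H.
Qed.

Definition supp2 (E : nat -> nat -> Prop) f := forall i j, f`_j`_i != 0 -> E i j.
Definition supp (E : nat -> nat -> nat -> Prop) F :=
  forall i j n, F`_n`_j`_i != 0 -> E i j n.

Lemma sum_neq0 (V : zmodType) n (a : 'I_n -> V) :
  \sum_i a i != 0 -> exists i, a i != 0.
Proof.
move=> nz; apply/existsP; apply: contraNT nz; rewrite negb_exists => /forallP a0.
by rewrite big1 // => i _; apply/eqP; move: (a0 i); rewrite negbK.
Qed.

Lemma supp2M (E1 E2 E : nat -> nat -> Prop) f g :
  (forall i j i' j', E1 i j -> E2 i' j' -> E (i + i')%N (j + j')%N) ->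
  supp2 E1 f -> supp2 E2 g -> supp2 E (f * g).
Proof.
move=> EM Hf Hg i j; rewrite coefM coef_sum => /sum_neq0[v].
rewrite coefM => /sum_neq0[u]; rewrite mulf_eq0 negb_or => /andP[nzf nzg].
have := EM _ _ _ _ (Hf _ _ nzf) (Hg _ _ nzg).
by rewrite !subnKC // -ltnS.
Qed.

Lemma suppM (E1 E2 E : nat -> nat -> nat -> Prop) F G :
  (forall i j n i' j' n', E1 i j n -> E2 i' j' n' ->
     E (i + i')%N (j + j')%N (n + n')%N) ->
  supp E1 F -> supp E2 G -> supp E (F * G).
Proof.
move=> EM HF HG i j n; rewrite coefM !coef_sum => /sum_neq0[w].
move: i j; rewrite -/(supp2 (fun i j => E i j n) _).
apply: (supp2M (E1 := fun i j => E1 i j w) (E2 := fun i j => E2 i j (n - w)%N)) => //.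
- move=> i' j' i'' j'' E1w E2w; have := EM _ _ _ _ _ _ E1w E2w.
  by rewrite subnKC // -ltnS.
- by move=> u v /HF.
- by move=> u v /HG.
Qed.

Lemma supp2D E f g : supp2 E f -> supp2 E g -> supp2 E (f + g).
Proof.
move=> Hf Hg i j; rewrite !coefD.
have [->|/Hf //] := eqVneq f`_j`_i 0; rewrite add0r; exact: Hg.
Qed.

Lemma suppD E F G : supp E F -> supp E G -> supp E (F + G).
Proof.
move=> HF HG i j n; rewrite !coefD.
have [->|/HF //] := eqVneq F`_n`_j`_i 0; rewrite add0r; exact: HG.
Qed.

Lemma suppN E F : supp E F -> supp E (- F).
Proof. by move=> HF i j n; rewrite !coefN oppr_eq0; apply: HF. Qed.

Lemma supp0 E : supp E 0.
Proof. by move=> i j n; rewrite !coef0 eqxx. Qed.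

Lemma mono2_coef i j u v : (mono2 i j)`_v`_u = ((u == i) && (v == j))%:R.
Proof.
rewrite /mono2 /varx /vary -polyC_exp coefCM coefXn.
by case: (v == j); rewrite ?mulr1 ?mulr0 ?andbT ?andbF ?coefXn ?coef0.
Qed.

Lemma mono_coef i j n u v w :
  (mono i j n)`_w`_v`_u = [&& u == i, v == j & w == n]%:R.
Proof.
rewrite /mono coefCM coefXn; case: eqP => _; rewrite ?mulr1 ?mulr0 ?andbT ?andbF.
  exact: mono2_coef.
by rewrite !coef0.
Qed.

Lemma mono_cst_coefM (c : k) F i j n : (c%:P%:P%:P * F)`_n`_j`_i = c * F`_n`_j`_i.
Proof. by rewrite !coefCM. Qed.

Lemma supp_mono E i j n (c : k) : E i j n -> supp E (c%:P%:P%:P * mono i j n).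
Proof.
move=> Eijn u v w; rewrite mono_cst_coefM mono_coef.
case: and3P => [[/eqP-> /eqP-> /eqP->] //|_]; by rewrite mulr0 eqxx.
Qed.

Lemma supp2_mono E i j : E i j -> supp2 E (mono2 i j).
Proof.
move=> Eij u v; rewrite mono2_coef.
by case: andP => [[/eqP-> /eqP->] //|_]; rewrite eqxx.
Qed.
End Monomials.

(** * Finitely generated ideals *)

Section Ideals.
Variable A : comNzRingType.
Implicit Types (gs : seq A) (f g : A).

Lemma in_ideal0 gs : in_ideal gs 0.
Proof.
exists (nseq (size gs) 0); rewrite size_nseq; split=> //.
by rewrite big1 // => i _; rewrite nth_nseq ltn_ord mul0r.
Qed.

Lemma in_idealD gs f g : in_ideal gs f -> in_ideal gs g -> in_ideal gs (f + g).
Proof.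
move=> [cs [szc ->]] [es [sze ->]].
exists [seq cs`_i + es`_i | i <- iota 0 (size gs)]; rewrite size_map size_iota; split=> //.
rewrite -big_split /=; apply: eq_bigr => i _.
by rewrite -mulrDl (nth_map 0%N) ?size_iota // nth_iota.
Qed.

Lemma in_ideal_mul_gen gs g a : g \in gs -> in_ideal gs (a * g).
Proof.
move=> gsg; have lt_i : (index g gs < size gs)%N by rewrite index_mem.
exists (mkseq (fun i => if i == index g gs then a else 0) (size gs)).
rewrite size_mkseq; split=> //.
rewrite (bigD1 (Ordinal lt_i)) //= nth_mkseq // eqxx nth_index // big1 ?addr0 // => i.
by rewrite nth_mkseq // => /negPf; rewrite -val_eqE /= => ->; rewrite mul0r.
Qed.

Lemma in_ideal_ind gs (P : A -> Prop) : P 0 -> (forall f g, P f -> P g -> P (f + g)) ->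
  (forall a g, g \in gs -> P (a * g)) -> forall f, in_ideal gs f -> P f.
Proof.
move=> P0 PD PM _ [cs [_ ->]]; elim/big_ind: _ => // i _.
by apply: PM; rewrite mem_nth.
Qed.
End Ideals.

(* The monomial x^i y^j lies in I^n. *)
Definition Mon (d b i j n : nat) : bool :=
  [exists p : 'I_n.+1, exists r : 'I_n.+1,
     [&& p + r <= n, d * p + b * r <= i & d * (n - p - r) + (d - b) * r <= j]%N].

(** Here p, q, r count the factors x^d, y^d, x^b y^(d-b) in a product of n generators; [Mon]
    eliminates q and is a finite search. *)
Lemma MonP d b i j n : reflect
  (exists p q r, [/\ p + q + r = n, d * p + b * r <= i & d * q + (d - b) * r <= j]%N)
  (Mon d b i j n).
Proof.
apply: (iffP existsP) => [[p /existsP[r /and3P[le_n le_i le_j]]]|].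
  by exists p, (n - p - r)%N, r; split=> //; lia.
move=> [p [q [r [En le_i le_j]]]].
have lt_p : (p < n.+1)%N by lia.
have lt_r : (r < n.+1)%N by lia.
exists (Ordinal lt_p); apply/existsP; exists (Ordinal lt_r) => /=.
have -> : (n - p - r = q)%N by lia.
by apply/and3P; split=> //; lia.
Qed.

(** * The Rees algebra as a span of monomials *)

Section Rees.
Variables (k : fieldType) (d b : nat).
Local Notation Mon := (Mon d b).
Local Notation S := (rees (Igens k d b)).
Local Notation mono := (mono k).
Local Notation mono2 := (mono2 k).

Lemma Mon00 i j : Mon i j 0.
Proof. by apply/MonP; exists 0%N, 0%N, 0%N; rewrite !muln0. Qed.

Lemma MonM i j n i' j' n' : Mon i j n -> Mon i' j' n' ->
  Mon (i + i') (j + j') (n + n').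
Proof.
move=> /MonP[p [q [r [En Hi Hj]]]] /MonP[p' [q' [r' [En' Hi' Hj']]]].
apply/MonP; exists (p + p')%N, (q + q')%N, (r + r')%N.
by rewrite !mulnDr; split; lia.
Qed.

Lemma Mon_up i j n i' j' : (i <= i')%N -> (j <= j')%N -> Mon i j n -> Mon i' j' n.
Proof.
move=> le_i le_j /(MonM (Mon00 (i' - i) (j' - j))).
by rewrite add0n !subnK.
Qed.

(** All three generators have degree d. *)
Lemma Mon_weight i j n : (b <= d)%N -> Mon i j n -> (d * n <= i + j)%N.
Proof.
move=> le_bd /MonP[p [q [r [<- Hi Hj]]]]; rewrite !mulnDr.
have Er : (d * r = b * r + (d - b) * r)%N by rewrite -mulnDl subnKC.
lia.
Qed.

Lemma Igens_mono : Igens k d b = [:: mono2 d 0; mono2 0 d; mono2 b (d - b)].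
Proof. by rewrite /Igens /mono2 !expr0 mulr1 mul1r. Qed.

Lemma pow_gensP n g : reflect
  (exists p q r, (p + q + r = n)%N /\ g = mono2 (d * p + b * r) (d * q + (d - b) * r))
  (g \in pow_gens (Igens k d b) n).
Proof.
rewrite Igens_mono; elim: n g => [|n IHn] g.
  rewrite /= inE; apply: (iffP eqP) => [->|].
    exists 0%N, 0%N, 0%N; split=> //; by rewrite !muln0 /mono2 !expr0 mulr1.
  move=> [p [q [r [E ->]]]].
  have [-> [-> ->]] : p = 0%N /\ (q = 0%N /\ r = 0%N) by lia.
  by rewrite !muln0 /mono2 !expr0 mulr1.
apply: (iffP allpairsP) => [[[a m] [/= Ha /IHn[p [q [r [E ->]]]] ->]]|].
  move: Ha; rewrite !inE => /or3P[] /eqP->; rewrite mono2M.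
  - exists p.+1, q, r; split; first lia.
    by congr mono2; lia.
  - exists p, q.+1, r; split; first lia.
    by congr mono2; lia.
  - exists p, q, r.+1; split; first lia.
    by congr mono2; lia.
move=> [p [q [r [E ->]]]].
have memn p' q' r' : (p' + q' + r' = n)%N ->
    mono2 (d * p' + b * r') (d * q' + (d - b) * r')
      \in pow_gens [:: mono2 d 0; mono2 0 d; mono2 b (d - b)] n.
  by move=> En; apply/IHn; exists p', q', r'.
case: p E => [|p] E; first case: q E => [|q] E; first case: r E => [|r] E //.
- exists (mono2 b (d - b), mono2 (d * 0 + b * r) (d * 0 + (d - b) * r)); split=> /=.
  + by rewrite !inE eqxx !orbT.
  + by apply: memn; lia.
  + by rewrite mono2M; congr mono2; lia.
- exists (mono2 0 d, mono2 (d * 0 + b * r) (d * q + (d - b) * r)); split=> /=.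
  + by rewrite !inE eqxx !orbT.
  + by apply: memn; lia.
  + by rewrite mono2M; congr mono2; lia.
- exists (mono2 d 0, mono2 (d * p + b * r) (d * q + (d - b) * r)); split=> /=.
  + by rewrite !inE eqxx.
  + by apply: memn; lia.
  + by rewrite mono2M; congr mono2; lia.
Qed.

(** I^n is a monomial ideal, so membership is tested on each monomial separately; questions about S
    become arithmetic of exponents. *)
Lemma reesP F : S F <-> supp Mon F.
Proof.
split=> [SF i j n | HF n].
  move: i j; rewrite -/(supp2 (fun i j => Mon i j n) _).
  elim/in_ideal_ind: (SF n) => [i j|f g|a g].
  - by rewrite !coef0 eqxx.
  - exact: supp2D.
  case/pow_gensP=> p [q [r [En ->]]].
  apply: (supp2M (E1 := fun _ _ => True) (E2 := fun i j => Mon i j n)) => //.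
    by move=> i j i' j' _; apply: Mon_up; apply: leq_addl.
  by apply: supp2_mono; apply/MonP; exists p, q, r.
apply: mono2_ind => [|f g|i j /HF/MonP[p [q [r [En Hi Hj]]]]].
- exact: in_ideal0.
- exact: in_idealD.
rewrite -(subnK Hi) -(subnK Hj) -mono2M mulrA.
by apply: in_ideal_mul_gen; apply/pow_gensP; exists p, q, r.
Qed.

Lemma rees0 : S 0. Proof. by apply/reesP; apply: supp0. Qed.
Lemma reesD F G : S F -> S G -> S (F + G).
Proof. by rewrite !reesP; apply: suppD. Qed.
Lemma reesN F : S F -> S (- F).
Proof. by rewrite !reesP; apply: suppN. Qed.
Lemma reesM F G : S F -> S G -> S (F * G).
Proof. by rewrite !reesP; apply: suppM; apply: MonM. Qed.
Lemma rees_cmono (c : k) i j n : Mon i j n -> S (c%:P%:P%:P * mono i j n).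
Proof. by move=> H; apply/reesP; apply: supp_mono. Qed.
Lemma rees_mono i j n : Mon i j n -> S (mono i j n).
Proof. by move/(rees_cmono 1); rewrite !polyC1 mul1r. Qed.

Lemma rees_cst (c : k) : S c%:P%:P%:P.
Proof.
have := rees_cmono c (Mon00 0 0).
by rewrite /mono /mono2 !expr0 !mulr1.
Qed.
Lemma rees1 : S 1. Proof. by have := rees_cst 1; rewrite !polyC1. Qed.

End Rees.

(** * Ideals of S with few generators, and truncation of regular sequences *)

Section SubIdeals.
Variables (k : fieldType) (S : RT k -> Prop).
Implicit Types F G : RT k.

Lemma in_sub_ideal_nil G : in_sub_ideal S [::] G <-> G = 0.
Proof.
split=> [[cs [_ [_ ->]]]|->]; first by rewrite big_ord0.
by exists [::]; rewrite big_ord0.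
Qed.

Lemma in_sub_ideal1 F G : in_sub_ideal S [:: F] G <-> exists2 a, S a & G = a * F.
Proof.
split=> [[cs [szc [Sc ->]]]|[a Sa ->]].
  case: cs szc Sc => [|a [|]] //= _ Sc.
  by exists a; [apply: Sc; left | rewrite big_ord1].
by exists [:: a]; split=> //; split=> [c /= [<-|]|] //; rewrite big_ord1.
Qed.

Lemma in_sub_ideal2 F F' G : in_sub_ideal S [:: F; F'] G <->
  exists a a', [/\ S a, S a' & G = a * F + a' * F'].
Proof.
split=> [[cs [szc [Sc ->]]]|[a [a' [Sa Sa' ->]]]].
  case: cs szc Sc => [|a [|a' [|]]] //= _ Sc.
  exists a, a'; split; first by apply: Sc; left.
    by apply: Sc; right; left.
  by rewrite !big_ord_recl big_ord0 addr0.
exists [:: a; a']; split=> //; split=> [c /= [<-|[<-|]]|] //.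
by rewrite !big_ord_recl big_ord0 addr0.
Qed.

Lemma In_nth (T : Type) (x0 : T) (s : seq T) i : (i < size s)%N -> List.In (nth x0 s i) s.
Proof. by elim: s i => [|x s IHs] [|i] //=; [left | move/IHs; right]. Qed.

Lemma In_take (T : Type) (x : T) (s : seq T) n : List.In x (take n s) -> List.In x s.
Proof. by elim: s n => [|y s IHs] [|n] //= [->|/IHs]; [left | right]. Qed.

(** Every combination of elements with zero constant term has zero constant term. *)
Lemma in_max_hom_proper fs : (forall F, List.In F fs -> max_hom S F) ->
  ~ in_sub_ideal S fs 1.
Proof.
move=> mfs [cs [szc [_ E]]]; have := congr1 (fun F : RT k => F`_0`_0`_0) E.
rewrite !coef1 /= !coef_sum big1 => [/eqP|i _]; first by rewrite oner_eq0.
have [_ f0] := mfs _ (In_nth 0 (ltn_ord i)).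
by rewrite coefM big_ord1 coefM big_ord1 coefM big_ord1 /= !subn0 f0 mulr0.
Qed.

(** [almost_CM] and [CM] ask for regular sequences of every length up to a bound; one long sequence
    provides them all by truncation. *)
Lemma depth_ge_prefix fs n : (n <= size fs)%N ->
  (forall F, List.In F fs -> max_hom S F) ->
  (forall i, (i < size fs)%N -> forall G, S G ->
     in_sub_ideal S (take i fs) (G * fs`_i) -> in_sub_ideal S (take i fs) G) ->
  depth_ge S (max_hom S) n.
Proof.
move=> le_n mfs reg; exists (take n fs); rewrite size_takel //; split=> //.
have mtake F : List.In F (take n fs) -> max_hom S F by move=> inF; apply: mfs; apply: In_take inF.
split=> //; split; last exact: in_max_hom_proper.
move=> i; rewrite size_takel // => lt_in G SG; rewrite nth_take // take_takel ?(ltnW lt_in) //.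
by apply: reg => //; apply: leq_trans le_n.
Qed.
End SubIdeals.

(** * The regular sequence (x^d - y^d) T, x *)

Section Difference.
Variables (k : fieldType) (d b : nat).
Hypotheses (b_gt0 : (0 < b)%N) (b_lt : (b < d)%N).
Local Notation Mon := (Mon d b).
Local Notation S := (rees (Igens k d b)).
Local Notation m := (max_hom S).
Local Notation mono := (mono k).
Implicit Types F G : RT k.

Definition difT : RT k := mono d 0 1 - mono 0 d 1.
Local Notation X := (mono 1 0 0).

Lemma difT_coefM F i j n : (difT * F)`_n.+1`_j`_i =
  (if (d <= i)%N then F`_n`_j`_(i - d) else 0) -
  (if (d <= j)%N then F`_n`_(j - d)`_i else 0).
Proof. by rewrite mulrBl !coefB !mono_coefM /= subn1 !subn0 !andbT. Qed.

Lemma Mon1E i j : Mon i j 1 = [|| d <= i, d <= j | (b <= i) && (d - b <= j)]%N.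
Proof.
apply/MonP/idP => [[p [q [r [E Hi Hj]]]]|/or3P[H|H|/andP[H H']]].
- case: p E Hi => [|[|p]] E Hi; last lia; last by apply/orP; left; lia.
  case: q E Hj => [|[|q]] E Hj; last lia; last by apply/orP; right; apply/orP; left; lia.
  have Er : r = 1%N by lia.
  by apply/orP; right; apply/orP; right; subst r; lia.
- by exists 1%N, 0%N, 0%N; split; lia.
- by exists 0%N, 1%N, 0%N; split; lia.
- by exists 0%N, 0%N, 1%N; split; lia.
Qed.

Lemma difT_rees : S difT.
Proof. by apply: reesD; [|apply: reesN]; apply: rees_mono; rewrite Mon1E leqnn ?orbT. Qed.

(** Either a factor x^d can be removed, or only y^d and x^b y^(d-b) occur, each contributing at
    least d - b to the exponent of y. *)
Lemma Mon_colon_x i j n : Mon (i + d) j n.+1 -> Mon i j n \/ ((d - b) * n <= j)%N.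
Proof.
case/MonP=> [[|p] [q [r [E Hi Hj]]]]; last first.
  by left; apply/MonP; exists p, q, r; split; lia.
right; apply: leq_trans Hj; rewrite -[n]/(n.+1.-1) -E add0n.
apply: (@leq_trans ((d - b) * q + (d - b) * r)); first by rewrite -mulnDr leq_mul2l; lia.
by rewrite leq_add2r leq_mul2r leq_subr orbT.
Qed.

Lemma Mon_colon_y i j n : Mon i (j + d) n.+1 -> Mon i j n \/ (b * n <= i)%N.
Proof.
case/MonP=> [p [[|q] [r [E Hi Hj]]]]; last first.
  by left; apply/MonP; exists p, q, r; split; lia.
right; apply: leq_trans Hi; rewrite -[n]/(n.+1.-1) -E addn0.
apply: (@leq_trans (b * p + b * r)); first by rewrite -mulnDr leq_mul2l; lia.
by rewrite leq_add2r leq_mul2r (ltnW b_lt) orbT.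
Qed.

(* Along the direction (d, -d), a monomial of F outside I^n can only be cancelled in
   (x^d - y^d) F by its neighbour, so the end points of such a chain are constrained
   by the two colon lemmas and are divisible by (x^b y^(d-b))^n. *)
Lemma rees_difT_saturated F : S (difT * F) -> S F.
Proof.
rewrite !reesP => SF i j n nz; have [//|nMon] := boolP (Mon i j n).
(* Induction on v, stepping from (u, v) to (u + d, v - d). The new monomial stays outside I^n, as
   y^d T would otherwise carry it to the missing x^(u+d) y^v T^(n+1); the chain cannot stop at v <
   d, where nothing cancels. *)
have SFc u v : F`_n`_v`_u != 0 -> ~~ Mon u v n -> ((d - b) * n <= v)%N.
  have [N] := ubnP v; elim: N u v => // N IHN u v lt_v nzF nM.
  have [|nMx] := boolP (Mon (u + d) v n.+1).
    by case/Mon_colon_x => // M; rewrite M in nM.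
  have /eqP : (difT * F)`_n.+1`_v`_(u + d) = 0.
    by apply/eqP; apply: contraNT nMx => /SF.
  rewrite difT_coefM leq_addl addnK.
  case: leqP => [le_dv|_]; last by rewrite subr0 (negPf nzF).
  rewrite subr_eq0 => /eqP E.
  apply: (leq_trans _ (leq_subr d v)); apply: (IHN (u + d)%N).
  - lia.
  - by rewrite -E.
  apply: contra nMx => M; have := MonM M (_ : Mon 0 d 1).
  by rewrite Mon1E leqnn orbT addn0 addn1 subnK // => ->.
have SFb u v : F`_n`_v`_u != 0 -> ~~ Mon u v n -> (b * n <= u)%N.
  have [N] := ubnP u; elim: N u v => // N IHN u v lt_u nzF nM.
  have [|nMx] := boolP (Mon u (v + d) n.+1).
    by case/Mon_colon_y => // M; rewrite M in nM.
  have /eqP : (difT * F)`_n.+1`_(v + d)`_u = 0.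
    by apply/eqP; apply: contraNT nMx => /SF.
  rewrite difT_coefM leq_addl addnK.
  case: leqP => [le_du|_]; last by rewrite sub0r oppr_eq0 (negPf nzF).
  rewrite subr_eq0 => /eqP E.
  apply: (leq_trans _ (leq_subr d u)); apply: (IHN _ (v + d)%N).
  - lia.
  - by rewrite E.
  apply: contra nMx => M; have := MonM M (_ : Mon d 0 1).
  by rewrite Mon1E leqnn addn0 addn1 subnK // => ->.
case/negP: (nMon); apply/MonP; exists 0%N, 0%N, n; rewrite !muln0 !add0n; split=> //.
  exact: SFb nz nMon.
exact: SFc nz nMon.
Qed.

Lemma divides_x F : (forall j n, F`_n`_j`_0 = 0) -> exists G, F = G * X.
Proof.
move=> F0; apply: (@mono_ind k (fun F => exists G, F = G * X)) => [|G H [G' ->] [H' ->]|[|i] j n].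
- by exists 0; rewrite mul0r.
- by exists (G' + H'); rewrite mulrDl.
- by rewrite F0 eqxx.
- move=> _; exists ((F`_n`_j`_i.+1)%:P%:P%:P * mono i j n).
  by rewrite -mulrA monoM addn1 !addn0.
Qed.

Lemma mono100_neq0 : X != 0.
Proof.
apply/eqP=> /(congr1 (fun F : RT k => F`_0`_0`_1)); rewrite mono_coef !coef0 /=.
by apply/eqP; rewrite oner_eq0.
Qed.

(** Modulo x, [difT] becomes -y^d T, which is not a zero divisor in k[y,T]; hence x divides G. The
    quotient W is only known to be a polynomial. *)
Lemma difT_coprime_x F G : F * X = G * difT ->
  exists W, F = W * difT /\ G = W * X.
Proof.
move=> E; have [j n|W EW] := @divides_x G.
  have := congr1 (fun F : RT k => F`_n.+1`_(j + d)`_0) E.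
  rewrite [F * X]mulrC [G * difT]mulrC mono_coefM difT_coefM /= leq_addl addnK.
  rewrite leqNgt (leq_ltn_trans (leq0n b)) //= sub0r => /eqP.
  by rewrite eq_sym oppr_eq0 => /eqP.
exists W; split=> //; apply: (mulIf mono100_neq0).
by rewrite E EW mulrAC.
Qed.

Lemma difT_neq0 : difT != 0.
Proof.
apply/eqP=> /(congr1 (fun F : RT k => F`_1`_0`_d)).
rewrite !coefB !mono_coef !coef0 eqxx /=.
have -> : (d == 0)%N = false by lia.
by rewrite subr0; apply/eqP; rewrite oner_eq0.
Qed.

(** The polynomial quotient W has [difT] times W in S, so saturation puts it in S. *)
Lemma difT_x_regular : weakly_regular2 S difT X.
Proof.
split=> [|a G Sa SG /difT_coprime_x [W [EG _]]]; first exact: difT_neq0.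
by exists W => //; apply: rees_difT_saturated; rewrite mulrC -EG.
Qed.

Lemma max_hom_mono i j n : Mon i j n -> (0 < i + j)%N -> m (mono i j n).
Proof.
move=> M pos; split; first exact: rees_mono.
rewrite mono_coef; case: and3P => // -[/eqP Ei /eqP Ej _]; move: pos; lia.
Qed.

Lemma max_hom_sub F G : m F -> m G -> m (F - G).
Proof.
move=> [SF F0] [SG G0]; split; first by apply: reesD => //; apply: reesN.
by rewrite !coefB F0 G0 subr0.
Qed.

Lemma depth_ge2 n : (n <= 2)%N -> depth_ge S m n.
Proof.
move=> le_n; apply: (depth_ge_prefix (fs := [:: difT; X])) => //.
  move=> F /= [<-|[<-|//]].
    apply: max_hom_sub; apply: max_hom_mono; rewrite ?Mon1E ?leqnn ?orbT //; lia.
  exact: max_hom_mono (Mon00 _ _ _ _) _.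
case=> [|[|//]] _ G SG /=.
  rewrite !in_sub_ideal_nil => /eqP; rewrite mulf_eq0 (negPf difT_neq0) orbF.
  by move/eqP.
rewrite !in_sub_ideal1 => -[a Sa E].
by have [W SW ->] := difT_x_regular.2 a G Sa SG E; exists W.
Qed.
End Difference.

(** * Depth less than 3 when d > 2 *)

Section Socle.
Variables (k : fieldType) (d b : nat).
Hypotheses (b_gt0 : (0 < b)%N) (b_lt : (b < d)%N).
Hypotheses (cop : coprime d b) (d_gt2 : (2 < d)%N).
Local Notation Mon := (Mon d b).
Local Notation S := (rees (Igens k d b)).
Local Notation m := (max_hom S).
Local Notation mono := (mono k).
Local Notation X := (mono 1 0 0).
Local Notation difT := (difT k d).
Implicit Types F G : RT k.

(** Since gK meets S in gS, S/gS embeds in K/gK; this is the preimage in K of its image. *)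
Definition mod_difT F := exists a t, S a /\ F = a + difT * t.

Lemma difT_mono i j n :
  difT * mono i j n = mono (i + d) j n.+1 - mono i (j + d) n.+1.
Proof. by rewrite mulrBl !monoM !add0n add1n (addnC d i) (addnC d j). Qed.

(** Modulo g, x^d T equals y^d T, so multiples of d move between the exponents of x and y once T
    occurs. *)
Lemma difT_shift i j n t : (0 < n)%N ->
  exists W, mono (i + d * t) j n = mono i (j + d * t) n + difT * W.
Proof.
case: n => // n _; elim: t i j => [|t IHt] i j.
  by exists 0; rewrite muln0 !addn0 mulr0 addr0.
have [W E] := IHt (i + d)%N j.
exists (W + mono i (j + d * t) n).
rewrite mulnS addnA E mulrDr difT_mono (addnC d) !addnA.
by ring.
Qed.

(** Shifting by multiples of d turns x^i into x^(br+e); the degree bound then leaves enough y for r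
    factors x^b y^(d-b) and n - r factors y^d. *)
Lemma mod_difT_mono c i j n r e : (0 < n)%N -> (r <= n)%N ->
  (d * n + e <= i + j)%N -> (b * r + e = i %[mod d])%N ->
  mod_difT (c%:P%:P%:P * mono i j n).
Proof.
move=> n_gt0 le_rn le_e eq_mod.
have le_br : (b * r <= d * n)%N by rewrite leq_mul // ltnW.
have Sj : Mon (b * r + e) (i + j - (b * r + e)) n.
  apply/MonP; exists 0%N, (n - r)%N, r; split; first lia; first lia.
  have Er : (d * r = b * r + (d - b) * r)%N by rewrite -mulnDl subnKC // ltnW.
  by rewrite mulnBr; have := leq_mul (leqnn d) le_rn; lia.
have Sc := rees_cmono c Sj.
have [le_i|lt_i] := leqP (b * r + e) i.
  have /dvdnP[t Et] : (d %| i - (b * r + e))%N by rewrite -eqn_mod_dvd // eq_mod.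
  have [W E] := difT_shift (b * r + e) j t n_gt0.
  exists (c%:P%:P%:P * mono (b * r + e) (i + j - (b * r + e)) n), (c%:P%:P%:P * W).
  split=> //; rewrite (mulrCA difT) -mulrDr; congr (_ * _).
  have -> : i = (b * r + e + d * t)%N by lia.
  by rewrite E; congr (mono _ _ _ + _); lia.
have /dvdnP[t Et] : (d %| b * r + e - i)%N by rewrite -eqn_mod_dvd ?(ltnW lt_i) // eq_mod.
have [W E] := difT_shift i (j - d * t) t n_gt0.
exists (c%:P%:P%:P * mono (b * r + e) (i + j - (b * r + e)) n), (- (c%:P%:P%:P * W)).
split=> //; rewrite mulrN (mulrCA difT) -mulrBr; congr (_ * _).
have -> : (b * r + e = i + d * t)%N by lia.
have -> : (i + j - (i + d * t) = j - d * t)%N by lia.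
rewrite E addrK; congr mono; lia.
Qed.

Lemma coprime_solve a : exists2 r, (r < d)%N & (b * r = a %[mod d])%N.
Proof.
have d_gt0 : (0 < d)%N by lia.
have [u v] := egcdnP d b_gt0; move: cop; rewrite coprime_sym /coprime => /eqP -> E _.
exists ((u * a) %% d)%N; first by rewrite ltn_mod.
by rewrite modnMmr mulnA (mulnC b) E mulnDl mul1n mulnAC modnMDl.
Qed.

(* A monomial of degree 0 for the weight i + j - d n; its class modulo (x^d - y^d) T
   is determined by the residue of i, and -b is the only residue modulo d that is not
   of the form b r with r <= d - 2. *)
Definition socle_elt : RT k := mono (d - b) (b + d * (d - 3)) (d - 2).

(** Multiplying by a monomial involving T raises the number of available factors to at least d - 1,
    which reaches every residue. For n = 0 the positive degree of the monomial leaves room for a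
    spare factor x. *)
Lemma socle_annihilated F : m F -> mod_difT (F * socle_elt).
Proof.
case=> /reesP SF F0.
apply: (@mono_ind k (fun F => mod_difT (F * socle_elt))).
- by exists 0, 0; split; [apply: rees0 | rewrite mul0r mulr0 addr0].
- move=> G H [a [t [Sa E]]] [a' [t' [Sa' E']]].
  exists (a + a'), (t + t'); split; first exact: reesD.
  by rewrite mulrDl E E'; ring.
move=> i j n nz; have le_w := Mon_weight (ltnW b_lt) (SF _ _ _ nz).
have pos : (0 < i + j)%N.
  case: (posnP (i + j)) => // ij0; move: nz.
  have [-> [-> ->]] : i = 0%N /\ (j = 0%N /\ n = 0%N).
    by split; [lia | split; first lia]; case: n le_w => // n; rewrite mulnS; lia.
  by rewrite F0 eqxx.
rewrite -mulrA monoM.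
have Ed : (d * (n + (d - 2)) = d * n + d + d * (d - 3))%N.
  have -> : (n + (d - 2) = n + 1 + (d - 3))%N by lia.
  by rewrite !mulnDr muln1.
have [r lt_r Er] := coprime_solve (i + (d - b)).
have [le_r|gt_r] := leqP r (n + (d - 2)).
  by apply: (@mod_difT_mono _ _ _ _ r 0); rewrite ?addn0 //; lia.
have [E1 En] : r = d.-1 /\ n = 0%N by lia.
(* Only r = d - 1 fails; using one extra x (e = 1) changes the residue to be solved, so r' differs
   from d - 1 and is at most d - 2. *)
have [r' lt_r' Er'] := coprime_solve (i + (d - b - 1)).
have Er1 : (b * r' + 1 = i + (d - b) %[mod d])%N.
  by rewrite -modnDml Er' modnDml; congr (_ %% _)%N; lia.
have ne_r : r' <> r.
  move=> Err; move: Er1; rewrite Err -Er => /eqP.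
  by rewrite -{2}[(b * r)%N]addn0 eqn_modDl mod0n modn_small //; lia.
by apply: (@mod_difT_mono _ _ _ _ r' 1); lia.
Qed.

(** On the chain of monomials (u t, v t), the S-part [a] vanishes, so the coefficients of W must
    propagate the value -1 to the end of the chain, where there is no monomial left to carry it. *)
Lemma socle_elt_notin : ~ mod_difT socle_elt.
Proof.
move=> [a [W [/reesP Sa E]]].
have Ed : (d - 2 = (d - 3).+1)%N by lia.
pose u t := (d - b + d * t)%N; pose v t := (b + d * (d - 3 - t))%N.
(* The degree is exactly d(d-2), so the inequalities of [MonP] are equalities; then d divides
   b(r+1), hence r + 1, although r <= d - 2. *)
have a0 t : (t <= d - 3)%N -> a`_(d - 2)`_(v t)`_(u t) = 0.
  move=> le_t; apply/eqP; apply: contraT => /Sa/MonP[p [q [r [En Hi Hj]]]].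
  have Er : (d * r = b * r + (d - b) * r)%N by rewrite -mulnDl subnKC // ltnW.
  have Eu : (u t + v t = d * (d - 2))%N.
    have -> : (d - 2 = 1 + t + (d - 3 - t))%N by lia.
    by rewrite /u /v !mulnDr; lia.
  have Eu2 : (u t = d * p + b * r)%N.
    by move: Eu; rewrite -En !mulnDr; lia.
  have : (d %| b * r.+1)%N.
    have -> : (b * r.+1 = d * t.+1 - d * p)%N by move: Eu2; rewrite /u !mulnS; lia.
    by rewrite -mulnBr dvdn_mulr.
  rewrite Gauss_dvdr // => /dvdn_leq; lia.
have step t : (t <= d - 3)%N -> (if (d <= v t)%N then W`_(d - 3)`_(v t - d)`_(u t) else 0) = -1.
  elim: t => [|t IHt] le_t.
    have := congr1 (fun F : RT k => F`_(d - 2)`_(v 0)`_(u 0)) E.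
    rewrite /socle_elt mono_coef !coefD a0 // add0r Ed difT_coefM.
    have -> : (d <= u 0)%N = false by rewrite /u; lia.
    by rewrite /u /v muln0 addn0 subn0 !eqxx sub0r => /esym/eqP; rewrite eqr_oppLR => /eqP.
  have := congr1 (fun F : RT k => F`_(d - 2)`_(v t.+1)`_(u t.+1)) E.
  rewrite /socle_elt mono_coef !coefD a0 // add0r Ed difT_coefM.
  have -> : (u t.+1 == d - b)%N = false by rewrite /u mulnS; lia.
  have -> : (d <= u t.+1)%N by rewrite /u mulnS; lia.
  have -> : (u t.+1 - d = u t)%N by rewrite /u mulnS; lia.
  have Ev : (v t = v t.+1 + d)%N.
    rewrite /v; have -> : (d - 3 - t = (d - 3 - t.+1).+1)%N by lia.
    by rewrite mulnS addnCA addnC.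
  rewrite -(IHt (ltnW le_t)) Ev leq_addl addnK /= => /esym/eqP.
  by rewrite subr_eq0 => /eqP.
have /eqP := step _ (leqnn _).
have -> : (d <= v (d - 3))%N = false by rewrite /v subnn; lia.
by rewrite eq_sym oppr_eq0 oner_eq0.
Qed.

Lemma depth_lt3 : ~ depth_ge S m 3.
Proof.
case=> fs [szfs [mfs [reg _]]].
case: fs szfs mfs reg => [|f1 [|f2 [|f3 [|]]]] //= _ mfs reg.
have [m1 m2 m3] : [/\ m f1, m f2 & m f3] by split; apply: mfs; tauto.
have [S1 S2 S3] : [/\ S f1, S f2 & S f3] by case: m1 m2 m3 => ? _ [? _] [? _].
have f10 : f1 != 0.
  apply/eqP=> E; have := reg 0%N isT 1 (rees1 _ _ _).
  rewrite /= !in_sub_ideal_nil E mulr0 => /(_ erefl) /eqP.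
  by rewrite oner_eq0.
have reg2 : weakly_regular2 S f1 f2.
  split=> // a G Sa SG EG; have := reg 1%N isT G SG; rewrite /= !in_sub_ideal1; apply.
  by exists a.
have reg3 g a a' : S g -> S a -> S a' -> g * f3 = a * f1 + a' * f2 ->
    exists c c', [/\ S c, S c' & g = c * f1 + c' * f2].
  move=> Sg Sa Sa' Eg; have := reg 2%N isT g Sg; rewrite /= !in_sub_ideal2; apply.
  by exists a, a'.
have mX : m X by apply: max_hom_mono; rewrite ?Mon00.
have [u [t [Su Eu]]] := socle_annihilated mX.
have [|a [a' [Sa Sa' Eu']]] := regular3_colon (@reesD k d b) (@reesN k d b) (@reesM k d b)
  S1 S2 S3 (difT_rees k b_gt0 b_lt) mX.1 Su reg2 reg3 (difT_x_regular k b_gt0 b_lt).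
  move=> f; rewrite !inE => fs.
  have mf : m f by case/or3P: fs => /eqP->.
  have [a [t' [Sa Ef]]] := socle_annihilated mf.
  (* Substitute f s = a + g t' into u f = x s f - g t f. The coefficient of g is a priori only a
     polynomial; saturation puts it in S. *)
  have E : u * f = (t' * X - t * f) * difT + a * X.
    have -> : u = X * socle_elt - difT * t by rewrite Eu addrK.
    have -> : a = f * socle_elt - difT * t' by rewrite Ef addrK.
    ring.
  exists (t' * X - t * f), a; split=> //.
  apply: (rees_difT_saturated b_gt0 b_lt).
  have -> : difT * (t' * X - t * f) = u * f - a * X by rewrite E; ring.
  by apply: reesD; [|apply: reesN]; apply: reesM => //; case: mf mX => ? _ [].
(* Comparing both expressions of u gives x (s - a') = g (t + a), so g divides s - a'. *)
have [|W [EW _]] := @difT_coprime_x k d b b_lt (socle_elt - a') (t + a).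
  by rewrite mulrBl mulrC Eu Eu'; ring.
apply: socle_elt_notin; exists a', W; split=> //.
by rewrite mulrC -EW addrC subrK.
Qed.
End Socle.

(** * The case d = 2: a regular sequence of length three *)

Section DegreeTwo.
Variable k : fieldType.
Local Notation S := (rees (Igens k 2 1)).
Local Notation m := (max_hom S).
Local Notation mono := (mono k).
Local Notation X := (mono 1 0 0).
Implicit Types F G : RT k.

(** Here I = (x,y)^2, so the degree bound is the only condition. *)
Lemma Mon21E i j n : Mon 2 1 i j n = (2 * n <= i + j)%N.
Proof.
apply/idP/idP => [/Mon_weight -> //|le_n].
apply/MonP.
have [le_j|lt_j] := leqP (2 * n) j; first by exists 0%N, n, 0%N; split; lia.
(* Take floor(j/2) factors y^2, one factor xy when j is odd, and x^2 for the rest. *)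
exists (n - (j + 1) %/ 2)%N, (j %/ 2)%N, ((j + 1) %/ 2 - j %/ 2)%N; split; lia.
Qed.

(** The strict inequality leaves degree at least 2n after division by x. *)
Lemma in_sub_ideal_x G : in_sub_ideal S [:: X] G <->
  supp (fun i j n => (0 < i)%N && (2 * n < i + j)%N) G.
Proof.
rewrite in_sub_ideal1; split=> [[a /reesP Sa ->] i j n|HG].
  rewrite mulrC mono_coefM; case: ifP => [/and3P[lt_i _ _] /Sa|]; last by rewrite eqxx.
  by rewrite Mon21E; lia.
apply: (@mono_ind k (fun F => exists2 a, S a & F = a * X)).
- by exists 0; [apply: rees0 | rewrite mul0r].
- by move=> F F' [a Sa ->] [a' Sa' ->]; exists (a + a'); [apply: reesD | rewrite mulrDl].
move=> i j n nz; have /andP[i_gt0 lt_n] := HG _ _ _ nz.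
exists ((G`_n`_j`_i)%:P%:P%:P * mono (i - 1) j n).
  by apply: rees_cmono; rewrite Mon21E; lia.
by rewrite -mulrA monoM !addn0 subnK.
Qed.

Lemma in_sub_ideal_x_yyT G : in_sub_ideal S [:: X; mono 0 2 1] G <->
  supp (fun i j n => (0 < i)%N && (2 * n < i + j)%N
     || [&& 1 < j, 0 < n & 2 * n <= i + j]%N) G.
Proof.
rewrite in_sub_ideal2; split=> [[a [a' [/reesP Sa /reesP Sa' ->]]]|HG].
  apply: suppD => i j n; rewrite mulrC mono_coefM.
    case: ifP => [/and3P[lt_i _ _] /Sa|]; last by rewrite eqxx.
    by rewrite Mon21E; lia.
  case: ifP => [/and3P[_ lt_j lt_n] /Sa'|]; last by rewrite eqxx.
  by rewrite Mon21E; lia.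
apply: (@mono_ind k (fun F => exists a a', [/\ S a, S a' & F = a * X + a' * mono 0 2 1])).
- by exists 0, 0; split; [apply: rees0 | apply: rees0 | rewrite !mul0r addr0].
- move=> F F' [a [a1 [Sa Sa1 ->]]] [a' [a1' [Sa' Sa1' ->]]].
  by exists (a + a'), (a1 + a1'); split; [apply: reesD | apply: reesD | rewrite !mulrDl addrACA].
move=> i j n nz; case/orP: (HG _ _ _ nz) => [/andP[i_gt0 lt_n]|/and3P[j_gt1 n_gt0 le_n]].
  exists ((G`_n`_j`_i)%:P%:P%:P * mono (i - 1) j n), 0; split.
  - by apply: rees_cmono; rewrite Mon21E; lia.
  - exact: rees0.
  by rewrite mul0r addr0 -mulrA monoM !addn0 subnK.
exists 0, ((G`_n`_j`_i)%:P%:P%:P * mono i (j - 2) (n - 1)); split.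
- exact: rees0.
- by apply: rees_cmono; rewrite Mon21E; lia.
by rewrite mul0r add0r -mulrA monoM !addn0 !subnK.
Qed.

Lemma depth_ge3_degree2 n : (n <= 3)%N -> depth_ge S m n.
Proof.
move=> le_n; apply: (depth_ge_prefix (fs := [:: X; mono 0 2 1; mono 0 1 0 - mono 2 0 1])) => //.
  by move=> F /= [<-|[<-|[<-|//]]]; try apply: max_hom_sub; apply: max_hom_mono; rewrite ?Mon21E.
case=> [|[|[|//]]] _ G SG; rewrite [take _ _]/= [_`__]/=.
- rewrite !in_sub_ideal_nil => /eqP; rewrite mulf_eq0 (negPf (mono100_neq0 k)) orbF.
  by move/eqP.
- rewrite !in_sub_ideal_x => HG i j w nz.
  have := HG i (j + 2)%N (w + 1)%N; rewrite mulrC mono_coefM !leq_addl /= !addnK subn0.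
  by move/(_ nz); lia.
rewrite !in_sub_ideal_x_yyT => HG i j w nz; move/reesP: SG => SG.
have := SG _ _ _ nz; rewrite Mon21E => le_w.
apply: contraT => nE.
(* For w = 0 the monomial is a power of y, and multiplication by y keeps it outside the ideal. *)
have [w0|w_gt0] := posnP w.
  have := HG i (j + 1)%N w.
  rewrite mulrC mulrBl !coefB !mono_coefM w0 leq_addl !addnK !subn0 /= ltnn andbF subr0.
  by rewrite w0 in nz nE * => /(_ nz); lia.
(* For w > 0, j <= 1 and i + j = 2w. The product with x^2 T is again outside the ideal, and the
   y-term cannot cancel it: that would need a monomial of degree below 2(w + 1). *)
have := HG (i + 2)%N j (w + 1)%N.
rewrite mulrC mulrBl !coefB !mono_coefM !leq_addl !addnK !subn0 /= andbT.
have -> : (if (0 < j)%N then G`_(w + 1)`_(j - 1)`_(i + 2) else 0) = 0.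
  case: ifP => // j_gt0; apply/eqP; apply: contraT => /SG; rewrite Mon21E; lia.
by rewrite sub0r oppr_eq0 => /(_ nz); lia.
Qed.
End DegreeTwo.

(** * Algebraic dependence of four polynomials in three variables *)

Section AlgebraicDependence.
Variable k : fieldType.
Implicit Types F G : RT k.

Lemma linear_dependence (I J : finType) (f : I -> J -> k) : (#|J| < #|I|)%N ->
  exists u : I -> k, (exists i, u i != 0) /\ forall j, \sum_i u i * f i j = 0.
Proof.
move=> lt_JI; pose M := \matrix_(p < #|I|, q < #|J|) f (enum_val p) (enum_val q).
have /rowV0Pn[w /sub_kermxP wM w0] : kermx M != 0.
  by rewrite kermx_eq0 -row_leq_rank -ltnNge (leq_ltn_trans (rank_leq_col M)).
exists (fun i => w 0 (enum_rank i)); split.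
  have /existsP[p wp] : [exists p, w 0 p != 0].
    apply: contraNT w0; rewrite negb_exists => /forallP w0.
    by apply/eqP/rowP => p; rewrite mxE; apply/eqP; move: (w0 p); rewrite negbK.
  by exists (enum_val p); rewrite enum_valK.
move=> j; have := congr1 (fun A : 'rV_#|J| => A 0 (enum_rank j)) wM.
rewrite !mxE => E; rewrite -[RHS]E (reindex_onto enum_val enum_rank) /=; last first.
  by move=> i _; rewrite enum_rankK.
rewrite (eq_bigl xpredT) => [|p]; last by rewrite enum_valK eqxx.
by apply: eq_bigr => p _; rewrite !mxE enum_valK enum_rankK.
Qed.

Definition box (D i j n : nat) : Prop := [/\ (i <= D)%N, (j <= D)%N & (n <= D)%N].

Lemma supp_box_exists F : exists D, supp (box D) F.
Proof.
apply: (@mono_ind k (fun F => exists D, supp (box D) F)).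
- by exists 0%N; apply: supp0.
- move=> G H [D HG] [D' HH]; exists (D + D')%N.
  by apply: suppD => i j n; [move/HG | move/HH] => -[? ? ?]; split; lia.
by move=> i j n _; exists (i + j + n)%N; apply: supp_mono; split; lia.
Qed.

Lemma supp_boxW D D' F : (D <= D')%N -> supp (box D) F -> supp (box D') F.
Proof. by move=> le_D HF i j n /HF[? ? ?]; split; lia. Qed.

Lemma supp_boxM D D' F G : supp (box D) F -> supp (box D') G ->
  supp (box (D + D')) (F * G).
Proof. by apply: suppM => i j n i' j' n' [? ? ?] [? ? ?]; split; lia. Qed.

Lemma supp_boxX D F e : supp (box D) F -> supp (box (D * e)) (F ^+ e).
Proof.
move=> HF; elim: e => [|e IHe]; last by rewrite exprS mulnS; apply: supp_boxM.
have := @supp_mono k (box 0) 0 0 0 1 (And3 isT isT isT).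
by rewrite expr0 muln0 mono000 mulr1 !polyC1.
Qed.

Lemma dependent4 (x0 x1 x2 x3 : RT k) :
  exists N (u : 'I_N * 'I_N * 'I_N * 'I_N -> k), (exists e, u e != 0) /\
    \sum_e (u e)%:P%:P%:P *
      (x0 ^+ e.1.1.1 * x1 ^+ e.1.1.2 * x2 ^+ e.1.2 * x3 ^+ e.2) = 0.
Proof.
have [D [H0 H1 H2 H3]] : exists D, [/\ supp (box D) x0, supp (box D) x1,
    supp (box D) x2 & supp (box D) x3].
  have [D0 H0] := supp_box_exists x0; have [D1 H1] := supp_box_exists x1.
  have [D2 H2] := supp_box_exists x2; have [D3 H3] := supp_box_exists x3.
  exists (D0 + D1 + D2 + D3)%N.
  by split; [move: H0 | move: H1 | move: H2 | move: H3]; apply: supp_boxW; lia.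
(* N^4 products lie in a space of dimension B^3, and B <= N (4D + 1) gives B^3 <= N^3 (4D + 1)^3 <
   N^4. *)
pose N := ((4 * D + 1) ^ 3).+1; pose B := (4 * (D * N)).+1.
pose V (e : 'I_N * 'I_N * 'I_N * 'I_N) :=
  x0 ^+ e.1.1.1 * x1 ^+ e.1.1.2 * x2 ^+ e.1.2 * x3 ^+ e.2.
have HV e : supp (box (4 * (D * N))) (V e).
  have -> : (4 * (D * N) = D * N + D * N + D * N + D * N)%N by lia.
  have le_e (i : 'I_N) : (D * i <= D * N)%N by rewrite leq_mul2l ltnW ?orbT.
  by do 3?[apply: supp_boxM]; apply: supp_boxW (le_e _) _; apply: supp_boxX.
have [|u [nz E]] := @linear_dependence _ ('I_B * 'I_B * 'I_B)%type
    (fun e q => (V e)`_q.2`_q.1.2`_q.1.1).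
  rewrite !card_prod !card_ord.
  have le_B : (B <= N * (4 * D + 1))%N by rewrite /B; lia.
  apply: (@leq_ltn_trans (N * N * N * (4 * D + 1) ^ 3)); last first.
    by rewrite ltn_pmul2l // !muln_gt0.
  apply: (leq_trans (leq_mul (leq_mul le_B le_B) le_B)).
  by rewrite !expnS expn0; apply/eq_leq; ring.
exists N, u; split=> //; apply/polyP => n; apply/polyP => j; apply/polyP => i.
rewrite !coef0 !coef_sum.
under eq_bigr do rewrite mono_cst_coefM.
have [/and3P[lt_i lt_j lt_n]|out] := boolP [&& i < B, j < B & n < B]%N.
  exact: (E (Ordinal lt_i, Ordinal lt_j, Ordinal lt_n)).
rewrite big1 // => e _; have [->|/HV[? ? ?]] := eqVneq (V e)`_n`_j`_i 0.
  by rewrite mulr0.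
by move: out; rewrite /B !ltnS; lia.
Qed.
End AlgebraicDependence.

(** * Krull dimension at most three *)

Section Dimension.
Variables (k : fieldType) (S : RT k -> Prop).
Hypotheses (SD : forall F G, S F -> S G -> S (F + G)) (SM : forall F G, S F -> S G -> S (F * G)).
Hypothesis (Scst : forall c : k, S c%:P%:P%:P).

Lemma cst_mulVf (c : k) : c != 0 -> (c^-1)%:P%:P%:P * c%:P%:P%:P = 1 :> RT k.
Proof.
move=> c0; have E1 := polyCM (c^-1) c; rewrite mulVf // polyC1 in E1.
have E2 := polyCM (c^-1)%:P c%:P; rewrite -E1 polyC1 in E2.
have E3 := polyCM (c^-1)%:P%:P c%:P%:P; rewrite -E2 polyC1 in E3.
by rewrite -E3.
Qed.

Lemma horner_morph_poly (A B : comNzRingType) (phi : {rmorphism A -> B}) (x : B) n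
    (E : nat -> A) :
  horner_morph (fun a => mulrC x (phi a)) (\poly_(i < n) E i) =
  \sum_(i < n) phi (E i) * x ^+ i.
Proof.
rewrite poly_def rmorph_sum; apply: eq_bigr => i _.
by rewrite -mul_polyC rmorphM rmorphXn /= horner_morphC horner_morphX.
Qed.

(** Substitute x for the new variable. If q X + c lands in P, then c = 0, because x and the value
    both vanish modulo P'; then primality of P and x outside P allow induction on q. *)
Lemma prime_chain_step (A : comNzRingType) (phi : {rmorphism A -> RT k})
    (P P' : RT k -> Prop) (x : RT k) :
  prime_ideal S P -> prime_ideal S P' -> (forall F, P F -> P' F) -> P' x -> ~ P x ->
  (forall a, S (phi a)) -> (forall a, a != 0 -> ~ P' (phi a)) ->
  exists psi : {rmorphism {poly A} -> RT k},
    [/\ forall n E, psi (\poly_(i < n) E i) = \sum_(i < n) phi (E i) * x ^+ i,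
        forall q, S (psi q) & forall q, q != 0 -> ~ P (psi q)].
Proof.
move=> [PS [P0 [PD [PM [_ Pprime]]]]] [PS' [P0' [PD' [PM' _]]]] PP' P'x nPx Sphi nP'phi.
pose psi : {rmorphism {poly A} -> RT k} := horner_morph (fun a => mulrC x (phi a)).
exists psi.
have Sx : S x by apply: PS'.
have psiE q c : psi (q * 'X + c%:P) = psi q * x + phi c.
  by rewrite rmorphD rmorphM /= horner_morphX horner_morphC.
have Spsi q : S (psi q).
  elim/poly_ind: q => [|q c Sq]; first by rewrite rmorph0; apply: PS.
  by rewrite psiE; apply: SD => //; apply: SM.
split=> //; first by move=> n E; apply: horner_morph_poly.
elim/poly_ind=> [|q c IHq]; first by rewrite eqxx.
have [-> nz|c0 _] := eqVneq c 0; rewrite psiE.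
  rewrite rmorph0 addr0 => /(Pprime _ _ (Spsi q) Sx)[|//].
  apply: IHq; apply: contraNneq nz => ->; by rewrite mul0r add0r polyC0.
move=> /PP' Pval; apply: (nP'phi _ c0).
have -> : phi c = (psi q * x + phi c) + (- 1)%:P%:P%:P * psi q * x.
  by rewrite !polyCN !polyC1; ring.
by apply: PD' => //; apply: PM' => //; apply: SM.
Qed.

Lemma krull_dim_le3 n : (3 < n)%N -> ~ krull_dim_ge S n.
Proof.
move=> lt_n [Ps [prime_Ps chain]].
have pick i : (i < n)%N -> exists x, [/\ Ps i.+1 x, ~ Ps i x & forall F, Ps i F -> Ps i.+1 F].
  by move=> lt_i; have [sub [x [Px nPx]]] := chain i lt_i; exists x.
have [x0 [P0x nPx0 sub0]] := pick 0%N (@ltn_trans 3 0 n isT lt_n).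
have [x1 [P1x nPx1 sub1]] := pick 1%N (@ltn_trans 3 1 n isT lt_n).
have [x2 [P2x nPx2 sub2]] := pick 2%N (@ltn_trans 3 2 n isT lt_n).
have [x3 [P3x nPx3 sub3]] := pick 3%N lt_n.
have prime i : (i <= 4)%N -> prime_ideal S (Ps i).
  by move=> le_i; apply: prime_Ps; apply: leq_trans lt_n.
(* Start from the constants, which avoid P_4 as units; each descent in the chain adds one
   variable. *)
pose phi0 : {rmorphism k -> RT k} := polyC \o polyC \o polyC.
have nP0 c : c != 0 -> ~ Ps 4%N (phi0 c).
  move=> c0 Pc; have [_ [_ [_ [PM [nP1 _]]]]] := prime 4%N isT; apply: nP1.
  by rewrite -(cst_mulVf c0); apply: PM.
have [phi1 [E1 S1 nP1]] :=
  prime_chain_step (phi := phi0) (prime 3%N isT) (prime 4%N isT) sub3 P3x nPx3 Scst nP0.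
have [phi2 [E2 S2 nP2]] :=
  prime_chain_step (prime 2%N isT) (prime 3%N isT) sub2 P2x nPx2 S1 nP1.
have [phi3 [E3 S3 nP3]] :=
  prime_chain_step (prime 1%N isT) (prime 2%N isT) sub1 P1x nPx1 S2 nP2.
have [phi4 [E4 _ nP4]] :=
  prime_chain_step (prime 0%N isT) (prime 1%N isT) sub0 P0x nPx0 S3 nP3.
have [N [u [[e ue] E]]] := dependent4 x0 x1 x2 x3.
(* Extends u by 0 to all naturals, so that the relation becomes an iterated polynomial with [x0] in
   the outermost variable. *)
pose c (n0 n1 n2 n3 : nat) : k := 
  if insub n0 is Some i0 then if insub n1 is Some i1 then if insub n2 is Some i2 then
  if insub n3 is Some i3 then u (i0, i1, i2, i3) else 0 else 0 else 0 else 0.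
have cE (i0 i1 i2 i3 : 'I_N) : c i0 i1 i2 i3 = u (i0, i1, i2, i3) by rewrite /c !valK.
pose Q := \poly_(n0 < N) \poly_(n1 < N) \poly_(n2 < N) \poly_(n3 < N) c n0 n1 n2 n3.
apply: (nP4 Q).
  apply/eqP => /(congr1 (fun Q : {poly {poly {poly {poly k}}}} =>
    Q`_e.1.1.1`_e.1.1.2`_e.1.2`_e.2)).
  rewrite !(coef_poly, ltn_ord) !coef0 cE; move: ue; case: (e) => [[[? ?] ?] ?] /=.
  by move=> nz E0; rewrite E0 eqxx in nz.
have [_ [P0 _]] := prime 0%N isT; move: P0; congr (Ps 0%N).
rewrite -E /Q; apply/esym.
transitivity (\sum_(e : 'I_N * 'I_N * 'I_N * 'I_N)
  (c e.1.1.1 e.1.1.2 e.1.2 e.2)%:P%:P%:P *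
    (x0 ^+ e.1.1.1 * x1 ^+ e.1.1.2 * x2 ^+ e.1.2 * x3 ^+ e.2)); last first.
  by apply: eq_bigr => -[[[i0 i1] i2] i3] _; rewrite cE.
rewrite -(pair_big xpredT xpredT (fun (p : 'I_N * 'I_N * 'I_N) (i3 : 'I_N) =>
  (c p.1.1 p.1.2 p.2 i3)%:P%:P%:P *
  (x0 ^+ p.1.1 * x1 ^+ p.1.2 * x2 ^+ p.2 * x3 ^+ i3))) /=.
rewrite -(pair_big xpredT xpredT (fun (p : 'I_N * 'I_N) (i2 : 'I_N) =>
  \sum_(i3 < N) (c p.1 p.2 i2 i3)%:P%:P%:P *
  (x0 ^+ p.1 * x1 ^+ p.2 * x2 ^+ i2 * x3 ^+ i3))) /=.
rewrite -(pair_big xpredT xpredT (fun i0 i1 : 'I_N =>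
  \sum_(i2 < N) \sum_(i3 < N) (c i0 i1 i2 i3)%:P%:P%:P *
  (x0 ^+ i0 * x1 ^+ i1 * x2 ^+ i2 * x3 ^+ i3))) /=.
rewrite E4; apply: eq_bigr => i0 _.
rewrite E3 mulr_suml; apply: eq_bigr => i1 _.
rewrite E2 !mulr_suml; apply: eq_bigr => i2 _.
rewrite E1 !mulr_suml; apply: eq_bigr => i3 _.
rewrite /=; ring.
Qed.
End Dimension.

(** * A chain of four primes, and the dimension of S *)

Section Chain.
Variables (k : fieldType) (d b : nat).
Local Notation S := (rees (Igens k d b)).
Local Notation mono := (mono k).

Lemma kernel_prime (D : idomainType) (phi : {rmorphism RT k -> D}) :
  prime_ideal S (fun F => S F /\ phi F = 0).
Proof.
split=> [F [] //|]; split; first by split; [apply: rees0 | rewrite rmorph0].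
split=> [F G [SF F0] [SG G0]|].
  by split; [apply: reesD | rewrite rmorphD F0 G0 addr0].
split=> [F G SF [SG G0]|].
  by split; [apply: reesM | rewrite rmorphM G0 mulr0].
split=> [[_ /eqP]|F G SF SG [_ /eqP]]; first by rewrite rmorph1 oner_eq0.
by rewrite rmorphM mulf_eq0 => /orP[] /eqP; [left | right].
Qed.

(* The contractions of 0, (T), (T, x) and (T, x, y). *)
Lemma krull_dim_ge3 : (0 < d)%N -> krull_dim_ge S 3.
Proof.
move=> d_gt0.
pose ev1 : {rmorphism RT k -> Rxy k} := horner_eval (0 : Rxy k).
pose ev2 : {rmorphism RT k -> {poly k}} := map_poly (horner_eval (0 : k)) \o ev1.
pose ev3 : {rmorphism RT k -> k} := horner_eval (0 : k) \o ev2.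
have ev1E F : ev1 F = F`_0 by rewrite /= /horner_eval horner_coef0.
have ev2E F j : (ev2 F)`_j = F`_0`_j`_0.
  by rewrite -ev1E /ev2 /= coef_map /= /horner_eval horner_coef0.
have ev3E F : ev3 F = F`_0`_0`_0 by rewrite -ev2E /ev3 /= /horner_eval horner_coef0.
have ev21 F : ev1 F = 0 -> ev2 F = 0.
  by rewrite ev1E => F0; apply/polyP => j; rewrite ev2E F0 !coef0.
have ev32 F : ev2 F = 0 -> ev3 F = 0 by rewrite ev3E -ev2E => ->; rewrite coef0.
exists (fun i F => S F /\
  match i with 0 => F = 0 | 1 => ev1 F = 0 | 2 => ev2 F = 0 | _ => ev3 F = 0 end).
split=> [[|[|[|[|//]]]] _|[|[|[|//]]] _]; try exact: kernel_prime.
- exact: (kernel_prime idfun).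
- split=> [F [SF ->]|]; first by split; [apply: rees0 | rewrite ev1E coef0].
  (* T itself is not in S, so x^d T is the witness. *)
  exists (mono d 0 1); split.
    split; first by apply: rees_mono; apply/MonP; exists 1%N, 0%N, 0%N; split; lia.
    by rewrite ev1E /mono coefMXn.
  case=> _ /(congr1 (fun F : RT k => F`_1`_0`_d)).
  by rewrite mono_coef !coef0 !eqxx /=; apply/eqP; rewrite oner_eq0.
- split=> [F [SF F0]|]; first by split=> //; apply: ev21.
  exists (mono 1 0 0); split.
    split; first exact: rees_mono (Mon00 _ _ _ _).
    by apply/polyP => j; rewrite ev2E mono_coef coef0.
  rewrite ev1E => -[_ /(congr1 (fun f : Rxy k => f`_0`_1))].
  by rewrite mono_coef !coef0 /=; apply/eqP; rewrite oner_eq0.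
- split=> [F [SF F0]|]; first by split=> //; apply: ev32.
  exists (mono 0 1 0); split.
    split; first exact: rees_mono (Mon00 _ _ _ _).
    by rewrite ev3E mono_coef.
  case=> _ /(congr1 (fun f : {poly k} => f`_1)).
  by rewrite ev2E mono_coef !coef0 /=; apply/eqP; rewrite oner_eq0.
Qed.

Lemma rees_krull_dim n : krull_dim_ge S n -> (n <= 3)%N.
Proof.
rewrite leqNgt => dim_n; apply/negP => lt_n; apply: krull_dim_le3 lt_n dim_n => //.
- exact: reesD.
- exact: reesM.
- exact: rees_cst.
Qed.
End Chain.

Theorem mainTheorem8 (k : fieldType) (d b : nat)
  (hd : (2 <= d)%N) (hb1 : (1 <= b)%N) (hb2 : (b <= d - b)%N)
  (hgcd : gcdn d b = 1%N) :
  almost_CM (rees (Igens k d b)) /\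
  (CM (rees (Igens k d b)) <-> d = 2%N).
Proof.
have b_lt : (b < d)%N by lia.
split; first by move=> n /rees_krull_dim le_n; apply: depth_ge2.
split=> [cm|d2 n /rees_krull_dim le_n].
  have [//|ne_d] := eqVneq d 2.
  have [] : ~ depth_ge (rees (Igens k d b)) (max_hom (rees (Igens k d b))) 3.
    by apply: depth_lt3 => //; [apply/eqP | lia].
  by apply: cm; apply: krull_dim_ge3; lia.
have b1 : b = 1%N by lia.
by rewrite d2 b1; apply: depth_ge3_degree2.
Qed.
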